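(* Let $p\ge1$ and $q$ be coprime integers, let $D$ be a link diagram or a tangle diagram, and let $D'$ be obtained from $D$ by a $\frac{p}{q}$-move. Then the groups of Fox $p$-colorings $Col_p(D)$ and $Col_p(D')$ are isomorphic.
   Context: A Fox $p$-coloring of a link or tangle diagram assigns to each arc (arcs run from undercrossing to undercrossing, or to a boundary point of the tangle; closed components without undercrossings are single arcs) an element of $\mathbf{Z}_p=\mathbf{Z}/p\mathbf{Z}$ such that at each crossing $a+c=2b$ in $\mathbf{Z}_p$, where $b$ is the color of the overcrossing and $a,c$ are the colors of the two undercrossing arcs. These colorings form the abelian group $Col_p(D)$ under addition. Rational tangles (Conway): consider 2-tangle diagrams in a disk with endpoints NW, NE, SW, SE. The identity tangle, of slope $0$, consists of two parallel horizontal arcs joining NW to NE and SW to SE. For an integer $a$, adding $a$ horizontal half-twists to a tangle means adding $|a|$ crossings in a row on the right between the NE and SE strands, with overcrossing strand of positive slope if $a>0$ and negative slope if $a<0$. For integers $a_1,\dots,a_n$, the rational tangle $T(a_1,\dots,a_n)$ is built as follows: start with the identity tangle with $a_1$ horizontal half-twists added; then for $i=2,\dots,n$ successively reflect the diagram in the NW–SE diagonal (keeping over/under information) and add $a_i$ horizontal half-twists on the right. It is the $\frac{p}{q}$-tangle, of slope $\frac{p}{q}$, if $\frac{p}{q}=a_n+\frac{1}{a_{n-1}+\cdots+\frac{1}{a_1}}$. By Conway's theorem, two rational tangles are ambient isotopic rel boundary if and only if their slopes are equal. A $\frac{p}{q}$-move on a diagram replaces an identity tangle (two parallel arcs in a disk)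 by the $\frac{p}{q}$-tangle. *)

(* Defs.v *)
From HB Require Import structures.
From mathcomp Require Import all_boot all_order all_algebra.

Set Implicit Arguments.
Unset Strict Implicit.
Unset Printing Implicit Defensive.

Import GRing.Theory.
Local Open Scope ring_scope.

(* ------------------------------------------------------------------------ *)
(* The four corners of a disk (endpoints of a 2-tangle, or the four places   *)
(* where the strands leave a small disk around a crossing).                  *)

Inductive corner : predArgType := NW | NE | SW | SE.

Definition corner_code (k : corner) : bool * bool :=
  match k with
  | NW => (true, true) | NE => (true, false)
  | SW => (false, true) | SE => (false, false)
  end.

Definition corner_decode (b : bool * bool) : corner :=
  match b with
  | (true, true) => NW | (true, false) => NE
  | (false, true) => SW | (false, false) => SE
  end.

Lemma corner_codeK : cancel corner_code corner_decode.
Proof. by case. Qed.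

HB.instance Definition _ := Finite.copy corner (can_type corner_codeK).

Definition ccw (k : corner) : corner :=
  match k with NW => SW | SW => SE | SE => NE | NE => NW end.
Definition cw (k : corner) : corner :=
  match k with NW => NE | NE => SE | SE => SW | SW => NW end.

(* the effect on corners of the reflection in the NW-SE diagonal *)
Definition flip (k : corner) : corner :=
  match k with NE => SW | SW => NE | NW => NW | SE => SE end.

Lemma flipK : involutive flip. Proof. by case. Qed.

(* ------------------------------------------------------------------------ *)
(* Diagrams.  A diagram with boundary points I is a graph whose vertices are *)
(* - crossings, drawn with overcrossing strand SW-NE (positive slope) and    *)
(*   undercrossing strand NW-SE; (x, k) is the corner k of the crossing x;   *)
(* - marks, auxiliary regular points subdividing the strands; (j, true) and  *)
(*   (j, false) are the two sides of the mark j;                             *)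
(* - boundary points.                                                        *)
(* The fixed-point free involution [edge] pairs the two ends of each edge.   *)
(* Marks let us describe components without crossings (a circle is a mark    *)
(* whose two sides are joined by an edge) and glue diagrams; diagrams are    *)
(* compared regardless of marks in [same_diagram].                           *)

Definition port (X M I : finType) : finType :=
  (X * corner + I + M * bool)%type.

Record diagram (I : finType) := Diagram {
  crossing : finType;
  mark : finType;
  edge : port crossing mark I -> port crossing mark I;
  edgeK : involutive edge;
  edge_neq : forall u, edge u != u }.

Definition ports (I : finType) (D : diagram I) : finType :=
  port (crossing D) (mark D) I.

Definition cport (I : finType) (D : diagram I) (x : crossing D) (k : corner) :
  ports D := inl (inl (x, k)).

Definition bport (I : finType) (D : diagram I) (i : I) : ports D :=
  inl (inr i).

Definition mport (I : finType) (D : diagram I) (j : mark D) (b : bool) :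
  ports D := inr (j, b).

(* ------------------------------------------------------------------------ *)
(* Planarity.  The surface is the sphere with one disk collapsed to a vertex *)
(* for each orbit of rho : I -> I; rho gives the counterclockwise order, as  *)
(* seen from that vertex, in which strands leave it.  Since the components   *)
(* of the graph are all required to be of genus 0, this is Euler's formula   *)
(* V + F = E + 2 C.                                                          *)

Definition node (I : finType) (rho : I -> I) (D : diagram I) (u : ports D) :
    ports D :=
  match u with
  | inl (inl (x, k)) => cport x (ccw k)
  | inl (inr i) => bport D (rho i)
  | inr (j, b) => mport j (~~ b)
  end.

Definition face (I : finType) (rho : I -> I) (D : diagram I) (u : ports D) :
  ports D := node rho (@edge I D u).

Definition planar (I : finType) (rho : I -> I) (D : diagram I) : bool :=
  (fcard (@node I rho D) predT + fcard (@face I rho D) predT ==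
   fcard (@edge I D) predT +
   2 * n_comp [rel u v : ports D | (edge u == v) || (node rho u == v)] predT)%N.

(* A tangle diagram in a disk whose m boundary points are numbered           *)
(* counterclockwise around the disk, hence clockwise as seen from the        *)
(* collapsed outside.  A link diagram is the case m = 0.                     *)
Record tangle_diagram (m : nat) := TangleDiagram {
  tdiagram :> diagram 'I_m;
  tdiagram_planar : planar (@ord_pred m) tdiagram }.

(* ------------------------------------------------------------------------ *)
(* following edges and going through marks, but not through crossings *)
Definition strand_link (I : finType) (D : diagram I) : rel (ports D) :=
  fun u v =>
    (edge u == v) ||
    match u, v with
    | inr (j, b), inr (j', b') => (j == j') && (b != b')
    | _, _ => false
    end.

(* also following the overcrossing strand of a crossing *)
Definition arc_link (I : finType) (D : diagram I) : rel (ports D) :=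
  fun u v =>
    strand_link u v ||
    match u, v with
    | inl (inl (x, k)), inl (inl (x', k')) =>
        (x == x') && ((k, k') \in [:: (SW, NE); (NE, SW)])
    | _, _ => false
    end.

Definition arcs (I : finType) (D : diagram I) : {set {set ports D}} :=
  [set [set v | connect (@arc_link I D) u v] | u : ports D].

Definition arc (I : finType) (D : diagram I) : finType :=
  {A : {set ports D} | A \in arcs D}.

Lemma arc_of_subproof (I : finType) (D : diagram I) (u : ports D) :
  [set v | connect (@arc_link I D) u v] \in arcs D.
Proof. exact: imset_f. Qed.

Definition arc_of (I : finType) (D : diagram I) (u : ports D) : arc D :=
  Sub [set v | connect (@arc_link I D) u v] (arc_of_subproof u).

Definition is_mark (I : finType) (D : diagram I) (u : ports D) : bool :=
  if u is inr _ then true else false.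

(* number of components without crossings *)
Definition free_circles (I : finType) (D : diagram I) : nat :=
  n_comp (@strand_link I D)
    [pred u | [forall v, connect (@strand_link I D) u v ==> is_mark v]].

(* D and E are the same diagram up to the names of crossings, the choice     *)
(* (for each crossing) of which end of the overcrossing strand is called SW, *)
(* and the marks.  The orientation of the plane is kept (crossings are only  *)
(* turned by a half turn).  As in any encoding by the combinatorial map, the *)
(* relative position of disjoint connected parts is not recorded; arcs and   *)
(* crossings do not depend on it.                                            *)
Definition same_diagram (I : finType) (D E : diagram I) : Prop :=
  exists (f : crossing D -> crossing E) (r : crossing D -> bool),
    let h (w : crossing D * corner + I) : crossing E * corner + I :=
      match w with
      | inl (x, k) => inl (f x, if r x then ccw (ccw k) else k)
      | inr i => inr i
      end in
    [/\ bijective f,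
        forall w w' : crossing D * corner + I,
          connect (@strand_link I D) (inl w) (inl w') =
          connect (@strand_link I E) (inl (h w)) (inl (h w'))
      & free_circles D = free_circles E].

(* ------------------------------------------------------------------------ *)
(* Fox p-colorings.  For p >= 1, 'I_p.-1.+1 is 'I_p with addition modulo p   *)
(* (the library's 'Z_p would be Z/2Z for p = 1).                             *)

Definition Zmod (p : nat) := 'I_p.-1.+1.

Definition is_fox_coloring (p : nat) (I : finType) (D : diagram I) :
    {pred {ffun arc D -> Zmod p}} :=
  fun f => [forall x : crossing D,
    f (arc_of (cport x NW)) + f (arc_of (cport x SE)) ==
    f (arc_of (cport x SW)) *+ 2].

Lemma is_fox_coloring_zmod_closed (p : nat) (I : finType) (D : diagram I) :
  zmod_closed (@is_fox_coloring p I D).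
Proof.
split=> [|f g /forallP fP /forallP gP]; apply/forallP => x.
  by rewrite !ffunE addr0 mul0rn.
rewrite !ffunE mulrnBl -(eqP (fP x)) -(eqP (gP x)).
by rewrite opprD addrACA.
Qed.

HB.instance Definition _ (p : nat) (I : finType) (D : diagram I) :=
  GRing.isZmodClosed.Build {ffun arc D -> Zmod p} (@is_fox_coloring p I D)
    (is_fox_coloring_zmod_closed p D).

Record Col (p : nat) (I : finType) (D : diagram I) := MkCol {
  col_fun :> {ffun arc D -> Zmod p};
  col_funP : col_fun \in @is_fox_coloring p I D }.

HB.instance Definition _ (p : nat) (I : finType) (D : diagram I) :=
  [isSub for @col_fun p I D].
HB.instance Definition _ (p : nat) (I : finType) (D : diagram I) :=
  [Choice of Col p D by <:].
HB.instance Definition _ (p : nat) (I : finType) (D : diagram I) :=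
  [SubChoice_isSubZmodule of Col p D by <:].

(* ------------------------------------------------------------------------ *)
(* Gluing.  A diagram in the complement of a disk has the corners of the     *)
(* hole as additional boundary points; [glue C T] fills the hole of C with   *)
(* the 2-tangle T, each of the four gluing points becoming a mark.           *)

Section Glue.
Variables (I : finType) (C : diagram (corner + I)%type) (T : diagram corner).

Let gport : finType :=
  port (crossing C + crossing T)%type (mark C + mark T + corner)%type I.

Definition glue_in (u : ports C + ports T) : gport :=
  match u with
  | inl (inl (inl (x, k))) => inl (inl (inl x, k))
  | inl (inl (inr (inl k))) => inr (inr k, false)
  | inl (inl (inr (inr i))) => inl (inr i)
  | inl (inr (j, b)) => inr (inl (inl j), b)
  | inr (inl (inl (x, k))) => inl (inl (inr x, k))
  | inr (inl (inr k)) => inr (inr k, true)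
  | inr (inr (j, b)) => inr (inl (inr j), b)
  end.

Definition glue_out (v : gport) : ports C + ports T :=
  match v with
  | inl (inl (inl x, k)) => inl (inl (inl (x, k)))
  | inl (inl (inr x, k)) => inr (inl (inl (x, k)))
  | inl (inr i) => inl (inl (inr (inr i)))
  | inr (inl (inl j), b) => inl (inr (j, b))
  | inr (inl (inr j), b) => inr (inr (j, b))
  | inr (inr k, false) => inl (inl (inr (inl k)))
  | inr (inr k, true) => inr (inl (inr k))
  end.

Lemma glue_inK : cancel glue_in glue_out.
Proof. by case=> [[[[x k]|[k|i]]|[j b]]|[[[x k]|k]|[j b]]]. Qed.

Lemma glue_outK : cancel glue_out glue_in.
Proof. by case=> [[[[x|x] k]|i]|[[[j|j]|k] []]]. Qed.

Definition glue_edge (v : gport) : gport :=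
  glue_in (match glue_out v with
           | inl u => inl (edge u)
           | inr u => inr (edge u)
           end).

Lemma glue_edgeK : involutive glue_edge.
Proof.
move=> v; rewrite /glue_edge -{2}[v]glue_outK.
by case: (glue_out v) => u; rewrite glue_inK edgeK.
Qed.

Lemma glue_edge_neq v : glue_edge v != v.
Proof.
rewrite /glue_edge -{2}[v]glue_outK (can_eq glue_inK).
by case: (glue_out v) => u; rewrite ?(inj_eq inl_inj) ?(inj_eq inr_inj) edge_neq.
Qed.

Definition glue : diagram I := Diagram glue_edgeK glue_edge_neq.

End Glue.

(* ------------------------------------------------------------------------ *)
Definition id_edge (u : port void void corner) : port void void corner :=
  match u with
  | inl (inr NW) => inl (inr NE)
  | inl (inr NE) => inl (inr NW)
  | inl (inr SW) => inl (inr SE)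
  | inl (inr SE) => inl (inr SW)
  | u => u
  end.

Lemma id_edgeK : involutive id_edge.
Proof. by case=> [[[[]]|[]]|[[]]]. Qed.

Lemma id_edge_neq u : id_edge u != u.
Proof. by case: u => [[[[]]|[]]|[[]]]. Qed.

Definition id_tangle : diagram corner := Diagram id_edgeK id_edge_neq.

Definition reflect_port (X M : finType) (u : port X M corner) :
    port X M corner :=
  match u with
  | inl (inl (x, k)) => inl (inl (x, flip k))
  | inl (inr k) => inl (inr (flip k))
  | inr jb => inr jb
  end.

Lemma reflect_portK (X M : finType) : involutive (@reflect_port X M).
Proof. by case=> [[[x k]|k]|jb] //=; rewrite flipK. Qed.

Section Reflect.
Variable T : diagram corner.

Definition reflect_edge (u : ports T) : ports T :=
  reflect_port (edge (reflect_port u)).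

Lemma reflect_edgeK : involutive reflect_edge.
Proof. by move=> u; rewrite /reflect_edge reflect_portK edgeK reflect_portK. Qed.

Lemma reflect_edge_neq u : reflect_edge u != u.
Proof.
by rewrite /reflect_edge (can2_eq (@reflect_portK _ _) (@reflect_portK _ _)) edge_neq.
Qed.

(* Reflection of T in the NW-SE diagonal: it maps overcrossing strands of    *)
(* positive slope to overcrossing strands of positive slope, so reflecting   *)
(* each crossing in place is consistent with the way crossings are drawn.    *)
Definition reflect_tangle : diagram corner :=
  Diagram reflect_edgeK reflect_edge_neq.

End Reflect.

(* A hole with one crossing on its right, between the NE and SE strands.     *)
(* The crossing is drawn in standard position if pos holds (overcrossing of  *)
(* positive slope), and otherwise rotated counterclockwise by a quarter turn *)
(* (overcrossing of negative slope).                                         *)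
Section Twist.
Variable pos : bool.

(* the position of the corner k of the crossing, and the corner at position k *)
Definition place (k : corner) : corner := if pos then k else ccw k.
Definition at_place (k : corner) : corner := if pos then k else cw k.

Let tport : finType := port unit void (corner + corner)%type.
Let cr (k : corner) : tport := inl (inl (tt, at_place k)).
Let hole (k : corner) : tport := inl (inr (inl k)).
Let out (k : corner) : tport := inl (inr (inr k)).

Definition twist_edge (u : tport) : tport :=
  match u with
  | inl (inl (_, k)) =>
      match place k with
      | NW => hole NE | SW => hole SE | NE => out NE | SE => out SE
      end
  | inl (inr (inl k)) =>
      match k with
      | NW => out NW | SW => out SW | NE => cr NW | SE => cr SW
      end
  | inl (inr (inr k)) =>
      match k with
      | NW => hole NW | SW => hole SW | NE => cr NE | SE => cr SE
      end
  | inr jb => inr jb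
  end.

Lemma twist_edgeK : involutive twist_edge.
Proof.
by rewrite /twist_edge /cr /place /at_place; case: pos => -[[[[] []]|[[]|[]]]|[[]]].
Qed.

Lemma twist_edge_neq u : twist_edge u != u.
Proof.
rewrite /twist_edge /cr /place /at_place.
by case: pos u => -[[[[] []]|[[]|[]]]|[[]]].
Qed.

Definition twist_exterior : diagram (corner + corner)%type :=
  Diagram twist_edgeK twist_edge_neq.

End Twist.

Definition add_twists (a : int) (T : diagram corner) : diagram corner :=
  iter `|a|%N (glue (twist_exterior (0 <= a))) T.

(* the rational tangle T(a, s_1, ..., s_k) *)
Definition rational_tangle (a : int) (s : seq int) : diagram corner :=
  foldl (fun T b => add_twists b (reflect_tangle T)) (add_twists a id_tangle) s.

(* Slopes are in Q extended by infinity, represented by None; infinity is    *)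
(* the slope of, for instance, T(0, 0).                                      *)
Definition slope_frac (p q : int) : option rat :=
  if q == 0 then None else Some (p%:Q / q%:Q).

Definition slope_inv (r : option rat) : option rat :=
  match r with
  | None => Some 0
  | Some x => if x == 0 then None else Some x^-1
  end.

Definition slope_add (b : int) (r : option rat) : option rat :=
  omap (fun x => b%:Q + x) r.

Definition slope (a : int) (s : seq int) : option rat :=
  foldl (fun r b => slope_add b (slope_inv r)) (Some a%:Q) s.

(* ------------------------------------------------------------------------ *)
(* Counterclockwise order seen from the (collapsed) hole, and from the       *)
(* (collapsed) outside of the disk.                                          *)
Definition exterior_rot (m : nat) (i : corner + 'I_m) : corner + 'I_m :=
  match i with
  | inl k => inl (ccw k)
  | inr j => inr (ord_pred j)
  end.

(* The disk where the move takes place is the hole of C (with any labelling  *)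
(* NW, SW, SE, NE of its endpoints in counterclockwise order): D is C with *)
(* an identity tangle in the hole, and D' is C with a rational tangle of     *)
(* slope p/q in the hole.                                                    *)
Definition pq_move (p q : int) (m : nat) (D D' : tangle_diagram m) : Prop :=
  exists (C : diagram (corner + 'I_m)%type) (a : int) (s : seq int),
    [/\ planar (@exterior_rot m) C,
        slope a s = slope_frac p q,
        same_diagram D (glue C id_tangle)
      & same_diagram D' (glue C (rational_tangle a s))].

(* Main.v *)
Require Import Defs.
From HB Require Import structures.
From mathcomp Require Import all_boot all_order all_algebra.
Import GRing.Theory.
Local Open Scope ring_scope.

Set Implicit Arguments.
Unset Strict Implicit.
Unset Printing Implicit Defensive.

(** A Fox coloring of a diagram with a hole filled by a 2-tangle [T] is a
    coloring of the outside together with a coloring of [T], agreeing at the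
    four corners.  Hence [T] only matters through the set of boundary colors
    (NW, NE, SW, SE) that extend to [T], provided that the extension is unique;
    two fillings with the same set give isomorphic groups
    ([glue_same_boundary_law_iso]).

    For rational tangles this set is computed by Conway's continued fraction.
    Write NE = NW + u and SW = NW + v.  In a coloring of the identity tangle
    u = 0, v is free, and SE = NW + u + v.  A half-twist on the right preserves
    v and the relation SE = NW + u + v, and replaces u by u + v or u - v
    according to its sign ([twist_law]); the reflection in the NW-SE diagonal
    exchanges u and v ([reflect_tangle_law]).  So, for a tangle of slope P/Q in
    lowest terms, the boundary colors are exactly those with (u, v) = (yP, yQ)
    for some y ([rational_tangle_fraction]).  This is the usual action of
    twists and reflections on slopes.

    When P/Q = p/q, modulo p the number P vanishes and Q is invertible, so that
    (u, v) = (0, w) with w arbitrary, as for the identity tangle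
    ([proportional_torsion]): replacing one by the other does not change the
    group of colorings.

    It remains to see that this group does not depend on the way a diagram is
    presented, by crossings up to half turns and by marks
    ([same_diagram_iso]).  Throughout, a coloring is seen as a function on
    ports satisfying local conditions, rather than as a function on arcs. *)

(** * Isomorphisms of abelian groups *)

Definition additive_iso (U V : zmodType) : Prop :=
  exists f : {additive U -> V}, bijective f.

Lemma additive_iso_trans (U V W : zmodType) :
  additive_iso U V -> additive_iso V W -> additive_iso U W.
Proof.
by move=> [f f_bij] [g g_bij]; exists (g \o f : {additive _ -> _}); apply: bij_comp.
Qed.

(** The isomorphisms below have no canonical formula, as they extend a coloring
    over new strands; an additive relation which is total and has trivial
    kernel on both sides is the graph of one. *)
Lemma additive_iso_of_rel (U V : zmodType) (R : U -> V -> bool) :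
    (forall u u' v v', R u v -> R u' v' -> R (u - u') (v - v')) ->
    (forall u, exists v, R u v) -> (forall v, exists u, R u v) ->
    (forall u, R u 0 -> u = 0) -> (forall v, R 0 v -> v = 0) ->
  additive_iso U V.
Proof.
move=> RB totU totV injU injV.
pose f u := xchoose (totU u); pose g v := xchoose (totV v).
have Rf u : R u (f u) by exact: (xchooseP (totU u)).
have Rg v : R (g v) v by exact: (xchooseP (totV v)).
have uniqV u v v' : R u v -> R u v' -> v = v'.
  move=> Rv Rv'; apply/eqP; rewrite -subr_eq0; apply/eqP/injV.
  by rewrite -(subrr u); apply: RB.
have uniqU u u' v : R u v -> R u' v -> u = u'.
  move=> Ru Ru'; apply/eqP; rewrite -subr_eq0; apply/eqP/injU.
  by rewrite -(subrr v); apply: RB.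
have fB : zmod_morphism f.
  by move=> u u'; apply: (uniqV _ _ _ (Rf (u - u'))); apply: RB; apply: Rf.
pose fA : {additive U -> V} := HB.pack f (GRing.isZmodMorphism.Build U V f fB).
exists fA; exists g => [u|v]; first exact: (uniqU _ _ _ (Rg _) (Rf _)).
exact: (uniqV _ _ _ (Rf _) (Rg _)).
Qed.

(** * Colorings as functions on ports *)

Section PortColoring.
Variable A : zmodType.

(** The conditions of a Fox coloring, stated without arcs: the color is kept
    along edges, through marks and along overcrossings.  The values lie in any
    abelian group, since the analysis of rational tangles uses nothing else. *)
Definition port_coloring (I : finType) (D : diagram I) (c : ports D -> A) :
    Prop :=
  [/\ forall u, c (edge u) = c u,
      forall j, c (mport j true) = c (mport j false),
      forall x, c (cport x NE) = c (cport x SW)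
    & forall x, c (cport x NW) + c (cport x SE) = c (cport x SW) *+ 2].

Variables (I : finType) (D : diagram I).
Implicit Types (c : ports D -> A) (u v : ports D).

Lemma port_coloring_strand_link c u v :
  port_coloring c -> strand_link u v -> c u = c v.
Proof.
case=> c_edge c_mark _ _ /orP[/eqP <- //|].
case: u v => [s|[j b]] [t|[j' b']] // /andP[/eqP <-].
by case: b b' => -[] // _; rewrite c_mark.
Qed.

Lemma port_coloring_strand c u v :
  port_coloring c -> connect (@strand_link I D) u v -> c u = c v.
Proof.
move=> cP /connectP[s]; elim: s u => [|w s IHs] u /= => [_ -> //|].
by case/andP=> /(port_coloring_strand_link cP) -> /IHs.
Qed.

Lemma port_coloring_arc_link c u v :
  port_coloring c -> arc_link u v -> c u = c v.
Proof.
move=> cP /orP[/(port_coloring_strand_link cP) //|].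
case: cP => _ _ c_over _.
case: u v => [[[x k]|i]|s] [[[x' k']|i']|t] // /andP[/eqP <-].
by rewrite !inE => /orP[] /eqP[-> ->]; rewrite -/(cport x _) c_over.
Qed.

Lemma port_coloring_arc c u v :
  port_coloring c -> connect (@arc_link I D) u v -> c u = c v.
Proof.
move=> cP /connectP[s]; elim: s u => [|w s IHs] u /= => [_ -> //|].
by case/andP=> /(port_coloring_arc_link cP) -> /IHs.
Qed.

Lemma strand_link_sym : symmetric (@strand_link I D).
Proof.
move=> u v; rewrite /strand_link.
congr (_ || _); first by rewrite (can2_eq (@edgeK _ _) (@edgeK _ _)) eq_sym.
by case: u v => [s|[j b]] [t|[j' b']] //; rewrite eq_sym [b == _]eq_sym.
Qed.

Lemma arc_link_sym : symmetric (@arc_link I D).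
Proof.
move=> u v; rewrite /arc_link strand_link_sym; congr (_ || _).
case: u v => [[[x k]|i]|s] [[[x' k']|i']|t] //; rewrite eq_sym.
by case: k k' => -[].
Qed.

Lemma strand_connect_sym : connect_sym (@strand_link I D).
Proof. exact: sym_connect_sym strand_link_sym. Qed.

Lemma arc_connect_sym : connect_sym (@arc_link I D).
Proof. exact: sym_connect_sym arc_link_sym. Qed.

Lemma arc_of_eq u v : arc_of u = arc_of v <-> connect (@arc_link I D) u v.
Proof.
split=> [/(congr1 val) /= /setP /(_ v)|uv]; first by rewrite !inE connect0.
by apply/val_inj/setP => w; rewrite !inE (same_connect arc_connect_sym uv).
Qed.

Lemma arc_of_surj (a : Defs.arc D) : exists u, a = arc_of u.
Proof. by have /imsetP[u _ def_a] := valP a; exists u; apply: val_inj. Qed.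

End PortColoring.

Section Col.
Variables (p : nat) (I : finType) (D : diagram I).

Definition color (c : Col p D) (u : ports D) : Zmod p := c (arc_of u).

Lemma colorB (c d : Col p D) u : color (c - d) u = color c u - color d u.
Proof. by rewrite /color /= !ffunE. Qed.

Lemma color0 u : color 0 u = 0.
Proof. by rewrite /color /= ffunE. Qed.

Lemma color_eq0 (c : Col p D) : (forall u, color c u = 0) -> c = 0.
Proof.
move=> c0; apply/val_inj/ffunP => a; have [u ->] := arc_of_surj a.
by rewrite ffunE; apply: c0.
Qed.

(** With [port_coloring_color], this identifies the Fox colorings with the port
    colorings: a port coloring is constant on arcs, hence descends to them. *)
Lemma color_port_coloring (c : Col p D) : port_coloring (color c).
Proof.
have arcE u v : arc_link u v -> color c u = color c v.
  by move=> uv; congr (c _); apply/arc_of_eq/connect1.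
split=> [u|j|x|x].
- by symmetry; apply: arcE; rewrite /arc_link /strand_link eqxx.
- by apply: arcE; rewrite /arc_link /strand_link /= eqxx orbT.
- by apply: arcE; rewrite /arc_link /= eqxx orbT.
by have /forallP/(_ x)/eqP := col_funP c.
Qed.

Lemma port_coloring_color (c : ports D -> Zmod p) :
  port_coloring c -> exists d : Col p D, forall u, color d u = c u.
Proof.
move=> cP; pose f := [ffun a : Defs.arc D => oapp c 0 [pick u in val a]].
have fE u : f (arc_of u) = c u.
  rewrite ffunE; case: pickP => [v|/(_ u)]; rewrite inE ?connect0 // => uv.
  by symmetry; apply: port_coloring_arc uv.
have fP : f \in @is_fox_coloring p I D.
  by apply/forallP => x; rewrite !fE; case: cP => _ _ _ ->.
by exists (MkCol fP).
Qed.

End Col.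

(** * Invariance under relabelling and change of marks *)

Section Relabel.
Variable I : finType.
Implicit Types D E : diagram I.

Definition relabel D E (f : crossing D -> crossing E) (r : crossing D -> bool)
    (w : crossing D * corner + I) : crossing E * corner + I :=
  match w with
  | inl (x, k) => inl (f x, if r x then ccw (ccw k) else k)
  | inr i => inr i
  end.

Definition relabelling D E (f : crossing D -> crossing E)
    (r : crossing D -> bool) : Prop :=
  [/\ bijective f,
      forall w w' : crossing D * corner + I,
        connect (@strand_link I D) (inl w) (inl w') =
        connect (@strand_link I E) (inl (relabel f r w)) (inl (relabel f r w'))
    & free_circles D = free_circles E].

Lemma relabelling_inv D E (f : crossing D -> crossing E) r :
    relabelling f r ->
  exists (g : crossing E -> crossing D) s,
    [/\ relabelling g s, cancel (relabel f r) (relabel g s)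
      & cancel (relabel g s) (relabel f r)].
Proof.
case=> [[g fK gK] f_conn f_circ]; exists g, (r \o g).
have hK : cancel (relabel f r) (relabel g (r \o g)).
  by case=> [[x k]|i] //=; rewrite fK; case: (r x) k => -[].
have hK' : cancel (relabel g (r \o g)) (relabel f r).
  by case=> [[x k]|i] //=; rewrite gK; case: (r _) k => -[].
split=> //; split=> // [|w w']; first by exists f.
by rewrite f_conn !hK'.
Qed.

(** One port on each component without crossings.  Two diagrams that are the same
    up to marks have equally many of them, and colorings are compared by
    matching these lists in order: no other correspondence between such
    components is given, and their colors are subject to no condition. *)
Definition free_roots D : seq (ports D) :=
  enum (predI (roots (@strand_link I D))
    [pred u | [forall v, connect (@strand_link I D) u v ==> is_mark v]]).

Lemma size_free_roots D : size (free_roots D) = free_circles D.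
Proof. by rewrite -cardE. Qed.

(** A strand either ends at a crossing or boundary point, or is a circle. *)
Lemma strand_cases D (u : ports D) :
  (exists w, connect (@strand_link I D) u (inl w)) \/
  fingraph.root (@strand_link I D) u \in free_roots D.
Proof.
have [/existsP|] := boolP [exists w, connect (@strand_link I D) u (inl w)].
  by left.
move/existsPn=> marks; right.
rewrite mem_enum !inE (roots_root (@strand_connect_sym _ D)) /=.
apply/forallP => -[w|j]; last exact: implybT.
apply/implyP => uw; case/negP: (marks w).
exact: connect_trans (connect_root _ _) uw.
Qed.

Lemma port_coloring_eq0 (A : zmodType) D (c : ports D -> A) :
    port_coloring c -> (forall w, c (inl w) = 0) ->
    {in free_roots D, forall u, c u = 0} ->
  forall u, c u = 0.
Proof.
move=> cP c_inl c_root u; have [[w uw]|/c_root <-] := strand_cases u.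
  by rewrite (port_coloring_strand cP uw).
exact: port_coloring_strand cP (connect_root _ _).
Qed.

(** A coloring is transported strand by strand: a strand of [E] that ends at a
    crossing or boundary point receives the color of the matching strand of [D],
    and the remaining circles receive the colors of the circles of [D]. *)
Lemma relabel_port_coloring (A : zmodType) D E (f : crossing D -> crossing E) r
    (c : ports D -> A) :
    relabelling f r -> port_coloring c ->
  exists d : ports E -> A,
    [/\ port_coloring d, forall w, d (inl (relabel f r w)) = c (inl w)
      & map d (free_roots E) = map c (free_roots D)].
Proof.
move=> [[g fK gK] f_conn f_circ] cP; set h := relabel f r.
pose e := @strand_link I E.
pose d v := if [pick w | connect e v (inl (h w))] is Some w then c (inl w)
  else nth 0 (map c (free_roots D)) (index (fingraph.root e v) (free_roots E)).
have d_link v v' : e v v' -> d v = d v'.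
  move=> /connect1 vv'; rewrite /d.
  rewrite (eqP (_ : fingraph.root e v == fingraph.root e v')); last first.
    by rewrite (root_connect (@strand_connect_sym _ E)).
  under eq_pick do rewrite (same_connect (@strand_connect_sym _ E) vv').
  by [].
have dE w : d (inl (h w)) = c (inl w).
  rewrite /d; case: pickP => [w'|/(_ w)]; last by rewrite connect0.
  by rewrite -f_conn => /(port_coloring_strand cP).
have dC x k : d (cport (f x) k) = c (cport x (if r x then ccw (ccw k) else k)).
  rewrite -dE /h /=; congr (d (inl (inl (_, _)))).
  by case: (r x) k => -[].
exists d; split=> //.
  case: cP => _ _ c_over c_under; split=> [u|j|y|y].
  - by symmetry; apply: d_link; rewrite /e /strand_link eqxx.
  - by apply: d_link; rewrite /e /strand_link /= eqxx orbT.
  - by rewrite -[y]gK !dC; case: (r _).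
  (* A half turn exchanges the two undercrossing ends, and the two
     overcrossing ends, which have the same color. *)
  rewrite -[y]gK !dC; case: (r _) => //=.
  by rewrite c_over -c_under addrC.
have sizeDE : size (free_roots E) = size (free_roots D).
  by rewrite !size_free_roots.
apply: (@eq_from_nth _ 0) => [|i]; rewrite !size_map // => lt_i.
have v0 : ports E by case: (free_roots E) lt_i.
rewrite (nth_map v0) //; set v := nth _ _ _.
have : v \in free_roots E by apply: mem_nth.
rewrite mem_enum !inE => /andP[/eqP v_root /forallP v_marks].
rewrite /d; case: pickP => [w vw|_]; first by have := v_marks (inl (h w)); rewrite vw.
by rewrite [fingraph.root _ _]v_root index_uniq ?enum_uniq.
Qed.

(** Both directions of the bijection come from [relabel_port_coloring], since a
    relabelling has an inverse relabelling. *)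
Lemma same_diagram_iso p D E :
  same_diagram D E -> additive_iso (Col p D) (Col p E).
Proof.
move=> [f [r fr]]; have {}fr : relabelling f r by [].
have [g [s [gs hK hK']]] := relabelling_inv fr.
pose h := relabel f r; pose h' := relabel g s.
pose R (c : Col p D) (d : Col p E) :=
  [forall w, color d (inl (h w)) == color c (inl w)] &&
  (map (color d) (free_roots E) == map (color c) (free_roots D)).
have sizeDE : size (free_roots E) = size (free_roots D).
  by rewrite !size_free_roots; case: fr.
apply: (@additive_iso_of_rel _ _ R) => [c c' d d'|c|d|c|d].
- move=> /andP[/forallP cd /eqP circ_cd] /andP[/forallP cd' /eqP circ_cd'].
  apply/andP; split.
    by apply/forallP => w; rewrite !colorB (eqP (cd w)) (eqP (cd' w)).
  have mapB (F : diagram I) (b b' : Col p F) t :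
      map (color (b - b')) t =
      map (fun xy => xy.1 - xy.2) (zip (map (color b) t) (map (color b') t)).
    by elim: t => //= u t ->; rewrite colorB.
  by rewrite !mapB circ_cd circ_cd'.
- have [d [/port_coloring_color[d' d'E] dE circ]] :=
    relabel_port_coloring fr (color_port_coloring c).
  exists d'; apply/andP; split; first by apply/forallP => w; rewrite d'E dE.
  by rewrite (eq_map d'E) circ.
- have [c [/port_coloring_color[c' c'E] cE circ]] :=
    relabel_port_coloring gs (color_port_coloring d).
  exists c'; apply/andP; split; last by rewrite (eq_map c'E) circ.
  by apply/forallP => w; rewrite c'E -cE hK.
- move=> /andP[/forallP c0 /eqP circ].
  apply: color_eq0; apply: port_coloring_eq0 (color_port_coloring c) _ _.
    by move=> w; rewrite -(eqP (c0 w)) color0.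
  move=> u u_root; have : color c u \in map (color c) (free_roots D).
    exact: map_f.
  by rewrite -circ => /mapP[v _ ->]; rewrite color0.
move=> /andP[/forallP d0 /eqP circ].
apply: color_eq0; apply: port_coloring_eq0 (color_port_coloring d) _ _.
  by move=> w; rewrite -[w]hK' (eqP (d0 _)) color0.
move=> u u_root; have : color d u \in map (color d) (free_roots E).
  exact: map_f.
by rewrite circ => /mapP[v _ ->]; rewrite color0.
Qed.

Lemma same_diagram_sym D E : same_diagram D E -> same_diagram E D.
Proof.
move=> [f [r fr]]; have {}fr : relabelling f r by [].
by have [g [s [gs _ _]]] := relabelling_inv fr; exists g, s.
Qed.

End Relabel.

(** * Colorings of glued diagrams *)

Section Glue.
Variables (A : zmodType) (I : finType).
Variables (C : diagram (corner + I)%type) (T : diagram corner).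

Definition outer_port (u : ports C) : ports (glue C T) := glue_in (inl u).
Definition inner_port (u : ports T) : ports (glue C T) := glue_in (inr u).

Definition hole_color (c : ports C -> A) (k : corner) : A :=
  c (bport C (inl k)).

Definition boundary_color (c : ports T -> A) (k : corner) : A := c (bport T k).

Lemma glue_edge_outer u : edge (outer_port u) = outer_port (edge u).
Proof. by rewrite /= /glue_edge glue_inK. Qed.

Lemma glue_edge_inner u : edge (inner_port u) = inner_port (edge u).
Proof. by rewrite /= /glue_edge glue_inK. Qed.

Lemma glue_coloring_restrict (c : ports (glue C T) -> A) :
    port_coloring c ->
  [/\ port_coloring (c \o outer_port), port_coloring (c \o inner_port)
    & hole_color (c \o outer_port) =1 boundary_color (c \o inner_port)].
Proof.
case=> c_edge c_mark c_over c_under; split=> [||k]; last 1 first.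
- exact/esym/(c_mark (inr k)).
- split=> [u|j|x|x] /=; first by rewrite -glue_edge_outer c_edge.
  + exact: (c_mark (inl (inl j))).
  + exact: (c_over (inl x)).
  exact: (c_under (inl x)).
split=> [u|j|x|x] /=; first by rewrite -glue_edge_inner c_edge.
- exact: (c_mark (inl (inr j))).
- exact: (c_over (inr x)).
exact: (c_under (inr x)).
Qed.

Lemma glue_coloring_extend (c1 : ports C -> A) (c2 : ports T -> A) :
    port_coloring c1 -> port_coloring c2 ->
    hole_color c1 =1 boundary_color c2 ->
  exists c : ports (glue C T) -> A,
    [/\ port_coloring c, c \o outer_port =1 c1 & c \o inner_port =1 c2].
Proof.
move=> [e1 m1 o1 u1] [e2 m2 o2 u2] c12.
pose c v := match @glue_out I C T v with inl u => c1 u | inr u => c2 u end.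
exists c; split=> [|u|u]; last 2 first.
- by rewrite /= /c glue_inK.
- by rewrite /= /c glue_inK.
split=> [v|[[j|j]|k]|[x|x]|[x|x]].
- rewrite /c /= /glue_edge glue_inK.
  by case: (glue_out v) => u; rewrite ?e1 ?e2.
- exact: m1.
- exact: m2.
- exact/esym/c12.
- exact: o1.
- exact: o2.
- exact: u1.
exact: u2.
Qed.

End Glue.

Arguments outer_port {I C T}.
Arguments inner_port {I C T}.

(** [S] is the set of boundary colors of [T], and a coloring of [T] is determined
    by its boundary colors; by additivity the latter is asked for the zero
    coloring only.  Keeping [S] arbitrary lets two tangles be compared without
    comparing their crossings. *)
Definition boundary_law (A : zmodType) (T : diagram corner)
    (S : (corner -> A) -> Prop) : Prop :=
  [/\ forall c : ports T -> A, port_coloring c -> S (boundary_color c),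
      forall b, S b ->
        exists2 c : ports T -> A, port_coloring c & boundary_color c =1 b
    & forall c : ports T -> A, port_coloring c ->
        (forall k, boundary_color c k = 0) -> forall u, c u = 0].

(** Colorings of the two fillings correspond when they agree outside the hole.
    The outside prescribes boundary colors that extend in one way to [T1] and
    in one way to [T2]. *)
Lemma glue_same_boundary_law_iso p (I : finType)
    (C : diagram (corner + I)%type) (T1 T2 : diagram corner)
    (S : (corner -> Zmod p) -> Prop) :
    boundary_law T1 S -> boundary_law T2 S ->
  additive_iso (Col p (glue C T1)) (Col p (glue C T2)).
Proof.
move=> law1 law2.
pose R (c1 : Col p (glue C T1)) (c2 : Col p (glue C T2)) :=
  [forall u : ports C, color c1 (outer_port u) == color c2 (outer_port u)].
have extend (T T' : diagram corner) (c : Col p (glue C T)) :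
    boundary_law T S -> boundary_law T' S ->
  exists c' : Col p (glue C T'),
    forall u : ports C, color c' (outer_port u) = color c (outer_port u).
  move=> [S_color _ _] [_ S_ex _].
  have [cC cT c_hole] := glue_coloring_restrict (color_port_coloring c).
  have /S_ex[t tP t_bd] := S_color _ cT.
  have [|d [dP dC _]] := glue_coloring_extend cC tP.
    by move=> k; rewrite t_bd c_hole.
  by have [c' c'E] := port_coloring_color dP; exists c' => u; rewrite c'E [LHS]dC.
have eq0 (T : diagram corner) (c : Col p (glue C T)) :
    boundary_law T S -> (forall u : ports C, color c (outer_port u) = 0) ->
  c = 0.
  move=> [_ _ det] c0; apply: color_eq0 => v.
  have [cC cT c_hole] := glue_coloring_restrict (color_port_coloring c).
  rewrite -[v]glue_outK; case: (glue_out v) => u; first exact: c0.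
  by apply: (det _ cT) => k; rewrite -c_hole /hole_color /= c0.
apply: (@additive_iso_of_rel _ _ R) => [c c' d d'|c|d|c|d].
- move=> /forallP cd /forallP cd'; apply/forallP => u.
  by rewrite !colorB (eqP (cd u)) (eqP (cd' u)).
- have [d dE] := extend _ _ c law1 law2.
  by exists d; apply/forallP => u; rewrite dE.
- have [c cE] := extend _ _ d law2 law1.
  by exists c; apply/forallP => u; rewrite cE.
- by move=> /forallP c0; apply: eq0 law1 _ => u; rewrite (eqP (c0 u)) color0.
by move=> /forallP d0; apply: eq0 law2 _ => u; rewrite -(eqP (d0 u)) color0.
Qed.

(** * Boundary colors of rational tangles *)

Section Fraction.
Variable A : zmodType.
Implicit Types (b : corner -> A) (P Q : int) (T : diagram corner).

(** The differences NE - NW and SW - NW are multiples of [P] and [Q] by the same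
    [y]: the pair ([P], [Q]) is read as a fraction, horizontal difference over
    vertical difference, so that (0, 1) is the identity tangle. *)
Definition proportional_by y P Q b : Prop :=
  [/\ b NE = b NW + y *~ P, b SW = b NW + y *~ Q
    & b SE = b NW + y *~ P + y *~ Q].

Definition proportional P Q b : Prop := exists y, proportional_by y P Q b.

Lemma eq_proportional P Q b b' :
  b =1 b' -> proportional P Q b -> proportional P Q b'.
Proof. by move=> bb' [y]; exists y; rewrite /proportional_by -!bb'. Qed.

Lemma id_tangle_law : boundary_law id_tangle (proportional 0 1).
Proof.
split=> [c [c_edge _ _ _]|b [y [bNE bSW bSE]]|c cP c0 u].
- have edgeE k : boundary_color c k = c (edge (bport id_tangle k)).
    by rewrite c_edge.
  exists (boundary_color c SW - boundary_color c NW).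
  rewrite /proportional_by mulr0z mulr1z !addr0 addrC subrK.
  by split; [exact: (edgeE NE)|by []|exact: (edgeE SE)].
- rewrite ?mulr0z ?mulr1z ?addr0 in bNE bSW bSE.
  exists (fun u => match u with inl (inr k) => b k | _ => 0 end) => //.
  split=> [[[[]|[]]|[[]]]|[]|[]|[]] //=; rewrite ?bNE ?bSE ?bSW //.
by case: u => [[[[]]|k]|[[]]]; apply: c0.
Qed.

Lemma reflect_port_coloring T (c : ports T -> A) :
  port_coloring c ->
  @port_coloring A _ (reflect_tangle T) (c \o @reflect_port _ _).
Proof.
case=> c_edge c_mark c_over c_under; split=> [u|j|x|x] /=.
- by rewrite /reflect_edge reflect_portK c_edge.
- exact: c_mark.
- exact/esym/c_over.
by rewrite [LHS]c_under -c_over.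
Qed.

Lemma reflect_port_coloring_inv T (c : ports (reflect_tangle T) -> A) :
  port_coloring c ->
  @port_coloring A _ T (c \o @reflect_port _ _).
Proof.
case=> c_edge c_mark c_over c_under; split=> [u|j|x|x] /=.
- by rewrite -[RHS]c_edge /= /reflect_edge reflect_portK.
- exact: c_mark.
- exact/esym/c_over.
by rewrite [LHS]c_under -c_over.
Qed.

Lemma proportional_flip P Q b :
  proportional P Q b -> proportional Q P (b \o flip).
Proof. by case=> y [? ? bSE]; exists y; split=> //=; rewrite addrAC. Qed.

Lemma reflect_tangle_law T P Q :
  boundary_law T (proportional P Q) ->
  boundary_law (reflect_tangle T) (proportional Q P).
Proof.
move=> [S_color S_ex det]; split=> [c cP|b|c cP c0 u].
- have := proportional_flip (S_color _ (reflect_port_coloring_inv cP)).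
  by apply: eq_proportional => k; rewrite /boundary_color /= flipK.
- move=> /proportional_flip/S_ex[c cP cb].
  exists (c \o @reflect_port _ _); first exact: reflect_port_coloring.
  by move=> k; have := cb (flip k); rewrite /= flipK.
rewrite -[u]reflect_portK.
by apply: (det _ (reflect_port_coloring_inv cP)) => k; apply: c0.
Qed.

Section Twist.
Variable pos : bool.

(** The colors at the four outer corners after a half-twist is added on the right
    of a tangle with boundary colors [b].  The overcrossing strand starts at SE
    and ends at NE if it has positive slope, and starts at NE and ends at SE
    otherwise; the undercrossing strand is reflected through its color. *)
Definition twist_color b (k : corner) : A :=
  match k with
  | NW => b NW
  | SW => b SW
  | NE => if pos then b SE else b NE *+ 2 - b SE
  | SE => if pos then b SE *+ 2 - b NE else b NE
  end.

Lemma twist_color_out (c : ports (twist_exterior pos) -> A) :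
    port_coloring c ->
  forall k, c (bport _ (inr k)) = twist_color (hole_color c) k.
Proof.
case=> c_edge _ /(_ tt) c_over /(_ tt) c_under k.
have holeE k' := c_edge (bport (twist_exterior pos) (inl k')).
rewrite -[LHS]c_edge /twist_color /hole_color.
move: c_over c_under (holeE NW) (holeE NE) (holeE SW) (holeE SE) => {holeE c_edge}.
rewrite /= /at_place /cport.
case: k; case: pos => /= over under hNW hNE hSW hSE //.
- by rewrite over.
- by rewrite -hNE over -under -hSE addrAC subrr add0r.
- by rewrite -hSE -under -hNE addrAC subrr add0r.
by rewrite -over.
Qed.

Lemma twist_color_ex b :
  exists2 c : ports (twist_exterior pos) -> A,
    port_coloring c & hole_color c =1 b.
Proof.
pose c (u : ports (twist_exterior pos)) : A :=
  match u with
  | inl (inl (_, k)) =>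
      match place pos k with
      | NW => b NE | SW => b SE | k' => twist_color b k'
      end
  | inl (inr (inl k)) => b k
  | inl (inr (inr k)) => twist_color b k
  | inr _ => 0
  end.
exists c => //; split=> [u|[]|x|x].
- move: u; rewrite /c /= /twist_color /at_place /place.
  by case: pos => -[[[[] []]|[[]|[]]]|[[]]].
- by rewrite /c /= /twist_color /place; case: pos.
rewrite /c /= /twist_color /place; case: pos => /=; first by rewrite addrC subrK.
by rewrite addrC subrK.
Qed.

(** A half-twist can be undone, so the outer colors determine those of the
    hole; this propagates uniqueness of the coloring. *)
Lemma twist_color_inj0 b :
  (forall k, twist_color b k = 0) -> forall k, b k = 0.
Proof.
move=> b0; have := (b0 NW, b0 SW, b0 NE, b0 SE); rewrite /=.
case: pos => -[[[bNW bSW] bNE] bSE]; case=> //.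
  by move: bSE; rewrite bNE mul0rn sub0r => /eqP; rewrite oppr_eq0 => /eqP.
by move: bNE; rewrite bSE mul0rn sub0r => /eqP; rewrite oppr_eq0 => /eqP.
Qed.

Lemma twist_coloring_eq0 (c : ports (twist_exterior pos) -> A) :
    port_coloring c -> (forall i, c (bport _ i) = 0) ->
  forall u, c u = 0.
Proof.
case=> c_edge _ _ _ c0 [[[[] k]|i]|[[]]]; last exact: c0.
rewrite -c_edge /=.
by case: (place pos k) => /=; [apply: (c0 (inl NE))|apply: (c0 (inr NE))|
  apply: (c0 (inl SE))|apply: (c0 (inr SE))].
Qed.

(** Adding a half-twist adds 1 or -1 to the slope [P] / [Q]. *)
Definition twist_num P Q : int := if pos then P + Q else P - Q.

Lemma proportional_by_twist y P Q b :
  proportional_by y P Q b ->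
  proportional_by y (twist_num P Q) Q (twist_color b).
Proof.
case=> bNE bSW bSE; rewrite /proportional_by /twist_num /twist_color.
set s := b NW + y *~ P in bNE bSE; set t := y *~ Q in bSW bSE *.
case: pos; rewrite bNE bSE; split=> //.
- by rewrite mulrzDr addrA.
- by rewrite mulrzDr addrA -/s mulr2n addrAC [s + t]addrC addrK addrC.
- by rewrite mulrzBr addrA mulr2n opprD addrA addrK.
by rewrite mulrzBr addrA subrK.
Qed.

Lemma proportional_untwist P Q b' :
    proportional (twist_num P Q) Q b' ->
  exists2 b, proportional P Q b & twist_color b =1 b'.
Proof.
case=> y [bNE bSW bSE].
pose b k := match k with
  | NW => b' NW | SW => b' NW + y *~ Q | NE => b' NW + y *~ P
  | SE => b' NW + y *~ P + y *~ Q end.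
have bP : proportional_by y P Q b by [].
exists b; first by exists y.
have [bNE' bSW' bSE'] := proportional_by_twist bP.
by case; rewrite ?bNE' ?bSW' ?bSE' ?bNE ?bSW ?bSE.
Qed.

Lemma eq_twist_color b b' : b =1 b' -> twist_color b =1 twist_color b'.
Proof. by move=> bb' k; rewrite /twist_color !bb'. Qed.

Lemma twist_law T P Q :
  boundary_law T (proportional P Q) ->
  boundary_law (glue (twist_exterior pos) T) (proportional (twist_num P Q) Q).
Proof.
move=> [S_color S_ex det]; split=> [c cP|b'|c cP c0 v].
- have [cC cT c_hole] := glue_coloring_restrict cP.
  have [y yP] := S_color _ cT.
  apply: eq_proportional (ex_intro _ y (proportional_by_twist yP)) => k.
  by rewrite -(eq_twist_color c_hole) -(twist_color_out cC).
- move=> /proportional_untwist[b /S_ex[t tP tb] bb'].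
  have [c1 c1P c1b] := twist_color_ex b.
  have [k|c [cP cC _]] := glue_coloring_extend c1P tP; first by rewrite c1b tb.
  exists c => // k; rewrite -bb' -(eq_twist_color c1b) -(twist_color_out c1P).
  exact: (cC (bport _ (inr k))).
have [cC cT c_hole] := glue_coloring_restrict cP.
have hole0 : forall k, hole_color (c \o outer_port) k = 0.
  by apply: twist_color_inj0 => k; rewrite -(twist_color_out cC); apply: c0.
rewrite -[v]glue_outK; case: (glue_out v) => u.
  by apply: (twist_coloring_eq0 cC) => -[]; [apply: hole0|apply: c0].
by apply: (det _ cT) => k; rewrite -c_hole hole0.
Qed.

End Twist.

Lemma add_twists_law a T P Q :
  boundary_law T (proportional P Q) ->
  boundary_law (add_twists a T) (proportional (P + a * Q) Q).
Proof.
move=> T_law; rewrite /add_twists.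
have iter_law n : boundary_law (iter n (glue (twist_exterior (0 <= a))) T)
    (proportional (if 0 <= a then P + n%:Z * Q else P - n%:Z * Q) Q).
  elim: n => [|n IHn] /=; first by rewrite mul0r ?addr0 ?subr0 if_same.
  have := twist_law (0 <= a) IHn; rewrite /twist_num.
  by case: (0 <= a); rewrite -addn1 PoszD mulrDl mul1r ?opprD addrA.
have := iter_law `|a|%N; case: a {iter_law} => n //=.
by rewrite NegzE -mulNr.
Qed.

(** The numerator and denominator are only known up to a common sign, hence are
    quantified existentially; being in lowest terms fixes the rest. *)
Definition has_fraction T (r : option rat) : Prop :=
  exists P Q, [/\ coprimez P Q, slope_frac P Q = r
    & boundary_law T (proportional P Q)].

Lemma slope_inv_frac P Q :
  coprimez P Q -> slope_inv (slope_frac P Q) = slope_frac Q P.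
Proof.
rewrite /slope_frac; have [->|Q0] := eqVneq Q 0.
  move=> copPQ; case: eqVneq => [P0|_]; first by rewrite P0 in copPQ.
  by rewrite mul0r.
move=> _ /=; rewrite mulf_eq0 invr_eq0 !intr_eq0 (negbTE Q0) orbF.
by case: eqVneq => // _; rewrite invf_div.
Qed.

Lemma slope_add_frac a P Q :
  slope_add a (slope_frac P Q) = slope_frac (P + a * Q) Q.
Proof.
rewrite /slope_frac; have [//|Q0] := eqVneq Q 0.
by rewrite /= intrD intrM mulrDl mulfK ?intr_eq0 // addrC.
Qed.

Lemma add_twists_fraction a T r :
  has_fraction T r -> has_fraction (add_twists a T) (slope_add a r).
Proof.
case=> P [Q [copPQ <- T_law]]; exists (P + a * Q), Q; split.
- by rewrite coprimez_sym /coprimez addrC gcdzMDl gcdzC.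
- by rewrite slope_add_frac.
exact: add_twists_law.
Qed.

Lemma reflect_tangle_fraction T r :
  has_fraction T r -> has_fraction (reflect_tangle T) (slope_inv r).
Proof.
case=> P [Q [copPQ <- T_law]]; exists Q, P; split.
- by rewrite coprimez_sym.
- by rewrite slope_inv_frac.
exact: reflect_tangle_law.
Qed.

Lemma rational_tangle_fraction a s :
  has_fraction (rational_tangle a s) (slope a s).
Proof.
have : has_fraction (add_twists a id_tangle) (Some a%:Q).
  have -> : Some a%:Q = slope_add a (slope_frac 0 1).
    by rewrite slope_add_frac /slope_frac /= add0r mulr1 divr1.
  by apply: add_twists_fraction; exists 0, 1; split=> //; apply: id_tangle_law.
rewrite /rational_tangle /slope.
elim: s (add_twists _ _) (Some _) => [//|b s IHs] T r Tr /=.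
by apply/IHs/add_twists_fraction/reflect_tangle_fraction.
Qed.

Lemma eq_boundary_law T (S S' : (corner -> A) -> Prop) :
  (forall b, S b <-> S' b) -> boundary_law T S -> boundary_law T S'.
Proof.
move=> SS' [S_color S_ex det]; split=> // [c /S_color/SS' //|b /SS'].
exact: S_ex.
Qed.

(** Modulo [n], multiples of [P] vanish, and by a Bezout relation [Q] is
    invertible, so that [y] times [Q] takes every value. *)
Lemma proportional_torsion (n : nat) P Q b :
    (forall x : A, x *+ n = 0) -> (n%:Z %| P)%Z -> coprimez n%:Z Q ->
  proportional P Q b <-> proportional 0 1 b.
Proof.
move=> An /dvdzP[m ->] /coprimezP[[u v] /= uv].
have A0 (x : A) i : x *~ (i * n%:Z) = 0 by rewrite mulrzA -pmulrn An.
split=> -[y [bNE bSW bSE]].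
  exists (y *~ Q); rewrite /proportional_by mulr0z mulr1z.
  by rewrite A0 in bNE bSE.
(* v is the inverse of Q modulo n *)
exists (y *~ v); rewrite /proportional_by A0.
rewrite -mulrzA mulrC.
have -> : y *~ (Q * v) = y *~ 1.
  by rewrite -uv mulrzDr A0 add0r mulrC.
by rewrite mulr0z in bNE bSE.
Qed.

End Fraction.

Lemma Zmod_mulrn p (x : Zmod p) : (0 < p)%N -> x *+ p = 0.
Proof.
case: p x => // p x _; rewrite Zp_mulrn.
by apply/val_inj; rewrite /= modnMl.
Qed.

(** Equality of slopes gives P q = p Q, also when both slopes are infinite, where
    both sides are 0.  As [p] and [q] are coprime, [p] divides [P], and then
    [Q], prime to [P], is prime to [p]. *)
Lemma slope_frac_dvd (p : nat) (q P Q : int) :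
    (0 < p)%N -> coprimez p%:Z q -> coprimez P Q ->
    slope_frac P Q = slope_frac p%:Z q ->
  (p%:Z %| P)%Z /\ coprimez p%:Z Q.
Proof.
move=> p_gt0 cop_pq cop_PQ PQpq.
have cross : P * q = p%:Z * Q.
  move: PQpq; rewrite /slope_frac.
  have [->|Q0] := eqVneq Q 0; first by have [->|//] := eqVneq q 0; rewrite !mulr0.
  have [//|q0 []] := eqVneq q 0.
  by move/eqP; rewrite eqr_div ?intr_eq0 // -!intrM eqr_int => /eqP.
have pP : (p%:Z %| P)%Z by rewrite -(Gauss_dvdzl _ cop_pq) cross dvdz_mulr.
by split=> //; apply: coprimez_dvdl pP cop_PQ.
Qed.

Lemma pq_move_fill_iso (p : nat) (q : int) (I : finType)
    (C : diagram (corner + I)%type) (a : int) (s : seq int) :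
    (0 < p)%N -> coprimez p%:Z q -> slope a s = slope_frac p%:Z q ->
  additive_iso (Col p (glue C id_tangle)) (Col p (glue C (rational_tangle a s))).
Proof.
move=> p_gt0 cop_pq slope_pq.
have [P [Q [cop_PQ PQ_slope law]]] := rational_tangle_fraction (Zmod p) a s.
have [|pP cop_pQ] := slope_frac_dvd p_gt0 cop_pq cop_PQ; first by rewrite PQ_slope.
apply: (@glue_same_boundary_law_iso p I C _ _ (proportional 0 1)).
- exact: id_tangle_law.
apply: eq_boundary_law law => b.
by apply: (proportional_torsion _ _ pP) => // x; apply: Zmod_mulrn.
Qed.

Theorem corollary2p5 (p : nat) (q : int) (m : nat) (D D' : tangle_diagram m)
    (hp : (1 <= p)%N) (hpq : coprimez p%:Z q) (hmove : pq_move p%:Z q D D') :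
  exists f : {additive Col p D -> Col p D'}, bijective f.
Proof.
case: hmove => C [a [s [_ slope_pq DC D'C]]].
apply: additive_iso_trans (same_diagram_iso p DC) _.
apply: additive_iso_trans (pq_move_fill_iso C hp hpq slope_pq) _.
exact: same_diagram_iso (same_diagram_sym D'C).
Qed.
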